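(* Let $n>0$, $k\in\{1,\ldots,n\}$ and $p\in\{0,\ldots,n-k\}$. Then, for every $\nu\in[0,1]$, the sequence $\left(\frac{\mathbb{E}_{\nu,d}(\tilde b_p)}{(n+1)!^d}\right)_{d\geq 0}$ is increasing and bounded from above.
   Context: ''Increasing'' is meant in the weak sense (non-decreasing). $\Delta_n$ is the standard $n$-simplex, $\partial\Delta_n$ its boundary. $\mathrm{Sd}(K)$ is the first barycentric subdivision of a simplicial complex $K$ and $\mathrm{Sd}^d(K)$ the $d$-th iterated one. A $q$-simplex of $\mathrm{Sd}(K)$ is written $[\hat\sigma_0,\ldots,\hat\sigma_q]$, where $\hat\sigma_i$ is the barycenter of a simplex $\sigma_i$ of $K$ and $\sigma_i$ is a proper face of $\sigma_{i+1}$. For $\sigma\in K$, $\overline{D}(\sigma)$ is the union of all closed simplices $[\hat\sigma_0,\ldots,\hat\sigma_q]$ of $\mathrm{Sd}(K)$ with $\sigma_0=\sigma$. For a simplicial cochain $\epsilon\in C^{k-1}(K;\mathbb{Z}/2\mathbb{Z})$, $V_\epsilon$ is the subcomplex of $\mathrm{Sd}(K)$ which is the union of the $\overline{D}(\sigma)$ over the $k$-simplices $\sigma$ of $K$ with $\langle d\epsilon,\sigma\rangle\neq 0$, where $d$ is the coboundary operator. For $\epsilon\in C^{k-1}(\mathrm{Sd}^d(\Delta_n);\mathbb{Z}/2\mathbb{Z})$ this is applied to the complex $\mathrm{Sd}^d(\Delta_n)$, so $V_\epsilon\subset\mathrm{Sd}^{d+1}(\Delta_n)$. $\mu_\nu$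 is the product probability measure on $C^{k-1}(\mathrm{Sd}^d(\Delta_n);\mathbb{Z}/2\mathbb{Z})$ for which the values of $\epsilon$ on the different $(k-1)$-simplices are independent, each being $0$ with probability $\nu$ and $1$ with probability $1-\nu$. Write $b_p(X)=\dim H_p(X;\mathbb{Z}/2\mathbb{Z})$. For $\epsilon\in C^{k-1}(\mathrm{Sd}^d(\Delta_n);\mathbb{Z}/2\mathbb{Z})$, $\tilde b_p(V_\epsilon)=\sum b_p(\Sigma_\epsilon)$, the sum being over all connected components $\Sigma_\epsilon$ of $V_\epsilon$ which do not intersect $\partial\Delta_n$, and $$\mathbb{E}_{\nu,d}(\tilde b_p)=\int_{C^{k-1}(\mathrm{Sd}^d(\Delta_n);\mathbb{Z}/2\mathbb{Z})}\tilde b_p(V_\epsilon)\,d\mu_\nu(\epsilon).$$ *)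

(* Defs.v *)
From HB Require Import structures.
From mathcomp Require Import all_boot all_order all_algebra.
From mathcomp Require Import reals.

Set Implicit Arguments.
Unset Strict Implicit.
Unset Printing Implicit Defensive.

Import Order.TTheory GRing.Theory Num.Theory.
Local Open Scope ring_scope.

(* A finite simplicial complex with vertices in [T] is the set of its simplices,
   each simplex being the nonempty set of its vertices. *)
Definition is_complex (T : finType) (K : {set {set T}}) : Prop :=
  (forall s, s \in K -> s != set0) /\
  (forall s t : {set T}, s \in K -> t != set0 -> t \subset s -> t \in K).

Section Homology.
Variables (T : finType) (K : {set {set T}}).

(* Indexed by the number of vertices: [face m.+1] is the type of m-simplices.
   In a complex [face 0] is empty, so that [bd 0] below is the zero map and the
   homology is the unreduced one. *)
Definition face (m : nat) : finType := {s : {set T} | (s \in K) && (#|s| == m)}.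

(* Both the chains and the cochains with values in Z/2Z. *)
Definition chain (m : nat) := {ffun face m -> ('F_2)^o}.

Definition bd (m : nat) (c : chain m.+1) : chain m :=
  [ffun t : face m => \sum_(s : face m.+1 | val t \subset val s) c s].

Definition cobd (m : nat) (e : chain m) : chain m.+1 :=
  [ffun s : face m.+1 => \sum_(t : face m | val t \subset val s) e t].

Fact bd_is_linear m : linear (@bd m).
Proof.
move=> a u v; apply/ffunP=> t; rewrite !ffunE scaler_sumr -big_split /=.
by apply: eq_bigr => s _; rewrite !ffunE.
Qed.

HB.instance Definition _ m :=
  GRing.isLinear.Build 'F_2 (chain m.+1) (chain m) _ (@bd m) (@bd_is_linear m).

Definition cycles (p : nat) : {vspace chain p.+1} := lker (linfun (@bd p)).
Definition boundaries (p : nat) : {vspace chain p.+1} :=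
  limg (linfun (@bd p.+1)).

(* dim H_p(K; Z/2Z); the subtraction is exact by [boundaries_sub_cycles]. *)
Definition betti (p : nat) : nat := (\dim (cycles p) - \dim (boundaries p))%N.

End Homology.

Arguments face {T} K m.
Arguments chain {T} K m.
Arguments cycles {T} K p.
Arguments boundaries {T} K p.
Arguments betti {T} K p.

Section Subdivision.
Variable T : finType.
Implicit Types K L : {set {set T}}.

(* The vertex of Sd(K) which is the barycenter of the simplex [s] of [K] is
   represented by [s] itself; simplices of Sd(K) are the nonempty flags. *)
Definition Sd K : {set {set {set T}}} :=
  [set c : {set {set T}} | [&& c != set0, c \subset K &
     [forall s in c, forall t in c, (s \subset t) || (t \subset s)]]].

(* All the faces of the simplices of Sd(K) whose first vertex is the
   barycenter of [s]. *)
Definition Dbar K (s : {set T}) : {set {set {set T}}} :=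
  [set c in Sd K | [exists f in Sd K,
     [&& c \subset f, s \in f & [forall t in f, s \subset t]]]].

(* [Veps e] for [e] a (k-1)-cochain. *)
Definition Veps K (k : nat) (e : chain K k) : {set {set {set T}}} :=
  \bigcup_(s : face K k.+1 | cobd e s != 0) Dbar K (val s).

Definition meets L : rel {set T} :=
  [rel s t | [&& s \in L, t \in L & s :&: t != set0]].

(* The connected components of a complex, each one as a subcomplex. *)
Definition components L : {set {set {set T}}} :=
  equivalence_partition (connect (meets L)) L.

End Subdivision.

Fixpoint iterV (T : finType) (d : nat) : finType :=
  if d is d'.+1 then {set iterV T d'} else T.

Fixpoint iterSd (T : finType) (K : {set {set T}}) (d : nat) :
    {set {set iterV T d}} :=
  if d is d'.+1 then Sd (iterSd K d') else K.

Definition Delta (n : nat) : {set {set 'I_n.+1}} := [set s | s != set0].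

Definition bdDelta (n : nat) : {set {set 'I_n.+1}} :=
  [set s | (s != set0) && (s != setT)].

(* [S] and the subdivided boundary are subcomplexes of Sd^(d+1)(Delta_n), so
   they meet as spaces iff they share a simplex. *)
Definition btilde (n d k p : nat) (e : chain (iterSd (Delta n) d) k) : nat :=
  (\sum_(S in components (Veps e) | [disjoint S & iterSd (bdDelta n) d.+1])
     betti S p)%N.

Section Expectation.
Variable R : realType.

(* The mass of [e] under the product measure; the cochain group is finite, so
   integrals are the finite sums weighted by [mu nu]. *)
Definition mu (T : finType) (K : {set {set T}}) (k : nat) (nu : R)
    (e : chain K k) : R :=
  \prod_(t : face K k) (if e t == 0 then nu else 1 - nu).

Definition Ebtilde (n k p : nat) (nu : R) (d : nat) : R :=
  \sum_(e : chain (iterSd (Delta n) d) k) mu nu e * (btilde p e)%:R.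

End Expectation.

Section Facts.

Lemma Sd_complex (T : finType) (K : {set {set T}}) : is_complex (Sd K).
Proof.
split=> [c|c f]; first by rewrite inE => /and3P[].
rewrite !inE => /and3P[_ cK /forall_inP chc] -> fc /=.
rewrite (subset_trans fc cK) /=; apply/forall_inP=> s sf; apply/forall_inP=> t tf.
by have /forall_inP := chc s (subsetP fc s sf); apply; apply: (subsetP fc).
Qed.

Lemma iterSd_complex (T : finType) (K : {set {set T}}) d :
  is_complex K -> is_complex (iterSd K d).
Proof. by case: d => [|d] // _; apply: Sd_complex. Qed.

Lemma Delta_complex n : is_complex (Delta n).
Proof. by split=> [s|s t]; rewrite !inE. Qed.

Lemma Veps_complex (T : finType) (K : {set {set T}}) k (e : chain K k) :
  is_complex (Veps e).
Proof.
have [SdP SdS] := Sd_complex K.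
split=> [c /bigcupP[s _]|c f /bigcupP[s es]].
  by rewrite inE => /andP[/SdP].
rewrite inE => /andP[cK /exists_inP[g gK /and3P[cg sg sming]]] f0 fc.
apply/bigcupP; exists s => //; rewrite inE (SdS c f cK f0 fc) /=.
by apply/exists_inP; exists g; rewrite // sg sming (subset_trans fc cg).
Qed.

Lemma meets_connect_equiv (T : finType) (L : {set {set T}}) :
  {in L & &, equivalence_rel (connect (meets L))}.
Proof.
have sym : connect_sym (meets L).
  by apply: sym_connect_sym => s t; rewrite /meets /= andbCA setIC.
move=> s t u _ _ _; split=> [|st]; first exact: connect0.
by apply/idP/idP=> [|tu]; [apply: connect_trans; rewrite sym | apply: connect_trans st tu].
Qed.

Lemma components_partition (T : finType) (L : {set {set T}}) :
  partition (components L) L.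
Proof. exact/equivalence_partitionP/meets_connect_equiv. Qed.

Lemma component_complex (T : finType) (L S : {set {set T}}) :
  is_complex L -> S \in components L -> is_complex S.
Proof.
case=> L0 LS /imsetP[x xL ->]; split=> [s|s t]; rewrite inE => /andP[sL xs].
  exact: L0.
move=> t0 ts; have tL := LS _ _ sL t0 ts; rewrite inE tL /=.
apply: connect_trans xs (connect1 _); rewrite /meets /= sL tL /=.
by rewrite (setIidPr ts).
Qed.

Lemma mu_total (R : realType) (T : finType) (K : {set {set T}}) k (nu : R) :
  \sum_(e : chain K k) mu nu e = 1.
Proof.
rewrite -(bigA_distr_bigA (fun _ (x : ('F_2)^o) =>
  if x == 0 then nu else 1 - nu)).
by apply: big1 => t _; rewrite !big_ord_recl big_ord0 /= addr0 addrC subrK.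
Qed.

Lemma bd_bd (T : finType) (K : {set {set T}}) m (c : chain K m.+2) :
  is_complex K -> bd (bd c) = 0.
Proof.
case=> K0 KS; apply/ffunP=> t; rewrite !ffunE.
under eq_bigr do rewrite ffunE.
rewrite (exchange_big_dep xpredT) //=; apply: big1 => r _.
rewrite sumr_const.
have [/andP[tK /eqP ct] /andP[rK /eqP cr]] := (valP t, valP r).
case: (boolP (val t \subset val r)) => [tr|ntr]; last first.
  rewrite (eq_card0 (A := _)) // => s; rewrite !inE; apply/negP=> /andP[ts sr].
  by case/negP: ntr; apply: subset_trans ts sr.
have : #|[pred s : face K m.+1 | (val t \subset val s) && (val s \subset val r)]|
       = 2.
  have cD : #|val r :\: val t| = 2.
    by rewrite cardsD (setIidPr tr) ct cr -addn2 addKn.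
  rewrite -cD -(card_in_imset (f := fun v => v |: val t)); last first.
    move=> v w; rewrite !inE => /andP[vt _] /andP[wt _] /setP/(_ v).
    by rewrite !in_setU1 eqxx (negPf vt) !orbF => /esym/eqP.
  rewrite -(card_imset _ val_inj); apply: eq_card => s.
  apply/imsetP/imsetP=> [[s' tsr ->]|[v]].
    have /andP[ts sr] := tsr; have /andP[sK /eqP cs] := valP s'.
    have : #|val s' :\: val t| == 1%N by rewrite cardsD (setIidPr ts) ct cs subSnn.
    case/cards1P=> v ev; exists v.
      have : v \in val s' :\: val t by rewrite ev set11.
      by rewrite !in_setD => /andP[-> /(subsetP sr) ->].
    by rewrite -ev setUC -{1}(setID (val s') (val t)) (setIidPr ts).
  rewrite in_setD => /andP[vt vr] ->.
  have vtr : v |: val t \subset val r by rewrite subUset sub1set vr.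
  have vK : v |: val t \in K.
    by apply: KS rK _ vtr; apply/set0Pn; exists v; rewrite !inE eqxx.
  have P : (v |: val t \in K) && (#|v |: val t| == m.+1).
    by rewrite vK cardsU1 vt ct add1n eqxx.
  by exists (Sub (v |: val t) P : face K m.+1); rewrite ?inE ?SubK ?subsetUr.
move=> E; rewrite (_ : #|_| = 2); last by rewrite -[RHS]E; apply: eq_card => s.
by rewrite mulr2n; exact: (addrr_pchar2 (pchar_Fp (isT : prime 2))).
Qed.

Lemma boundaries_sub_cycles (T : finType) (K : {set {set T}}) p :
  is_complex K -> (boundaries K p <= cycles K p)%VS.
Proof.
move=> HK; apply/subvP=> _ /memv_imgP[c _ ->].
by rewrite memv_ker !lfunE /= bd_bd.
Qed.

End Facts.

(* Main.v *)
From HB Require Import structures.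
Require Import Defs.
From mathcomp Require Import all_boot all_order all_algebra perm.
From mathcomp Require Import reals.

(** Write [D d] for the [d]-th subdivision of the simplex and [N] for
    [(n.+1)`!].  The top simplices of the first subdivision are the maximal
    flags of faces, hence are indexed by the [N] permutations [s] of the
    vertices, and over each of them [D d.+1] restricts to a copy of [D d].  The
    copy is the image of [D d] under an injective simplicial map [bary s d]:
    at depth 0 it sends the vertex [i] to the barycenter of the face
    [s 0, .., s i], and it is then propagated by taking images, since the
    vertices of a subdivision are the simplices of the previous complex.

    Monotonicity.  A cochain [e] on [D d.+1] restricts to a cochain
    [subpull e s] on each copy, and [Veps] commutes with this restriction
    ([Veps_simg], [Veps_preim]).  A simplex that meets the interior of a copy
    lies in that copy ([itermap_star]), so an interior component of
    [Veps (subpull e s)] is carried to a whole component of [Veps e], again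
    interior and with the same Betti numbers ([interior_component],
    [betti_simg]).  Different permutations give different components, because
    the interiors of two copies are disjoint ([itermap_sep]).  Hence
    [btilde e] is at least the sum over [s] of [btilde (subpull e s)].  The
    values of [e] being independent and identically distributed, each
    [subpull e s] has the law [mu] on [D d] ([sum_mu_pull]); taking expectations,
    [N * Ebtilde d <= Ebtilde d.+1], which is monotonicity after division by
    [N ^ d.+1].

    Boundedness.  The copies cover [D d.+1] ([itermap_cover]), so the number of
    simplices of [D d] is at most [N ^ d] times that of the simplex.  A Betti
    number of a complex is at most its number of simplices, and the components of
    [Veps e] are disjoint sets of simplices of [D d.+1], so [btilde e] is at
    most [#|D d.+1|]; the bound [N * #|Delta n|] follows. *)

Import Order.TTheory GRing.Theory Num.Theory.
Local Open Scope ring_scope.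

Set Implicit Arguments.
Unset Strict Implicit.
Unset Printing Implicit Defensive.

(** * Marginals of a product measure *)

(** Fixing the coordinates in the image of [h] leaves the weights of the other
    coordinates free, and those sum to 1: this is why the restriction of a
    family of independent variables is again a product. *)
Lemma sum_prod_restrict (R : comPzRingType) (I J X : finType) (h : I -> J)
    (w : X -> R) (F : {ffun I -> X} -> R) :
  injective h -> \sum_x w x = 1 ->
  \sum_(e : {ffun J -> X}) (\prod_j w (e j)) * F [ffun i => e (h i)] =
  \sum_(e : {ffun I -> X}) (\prod_i w (e i)) * F e.
Proof.
move=> hI w1.
rewrite (partition_big (fun e : {ffun J -> X} => [ffun i => e (h i)]) xpredT) //=.
apply: eq_bigr => e' _.
under eq_bigr => e /eqP eE do rewrite eE.
rewrite -mulr_suml; congr (_ * _).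
(* The values allowed at [j] when the restriction along [h] is [e']. *)
pose Q j : pred X := [pred x | [forall i, (h i == j) ==> (x == e' i)]].
rewrite (eq_bigl (fun e : {ffun J -> X} => e \in family Q)); last first.
  move=> e; apply/eqP/familyP => [eE j|eQ].
    by rewrite inE; apply/forallP=> i; rewrite -eE ffunE; apply/implyP=> /eqP->.
  apply/ffunP=> i; rewrite ffunE.
  by have := eQ (h i); rewrite inE => /forallP/(_ i); rewrite eqxx => /eqP.
rewrite -(bigA_distr_big_dep Q (fun=> w)) /=.
rewrite (bigID [in codom h]) /= [X in _ * X]big1 => [|j jh].
  rewrite mulr1 (eq_bigl [in h @: setT]); last first.
    by move=> j; apply/codomP/imsetP => [[i ->]|[i _ ->]]; exists i.
  rewrite big_imset => [|i j _ _]; last exact: hI.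
  rewrite /= (eq_bigl xpredT) => [|i]; last exact: in_setT.
  apply: eq_bigr => i _; rewrite (big_pred1 (e' i)) // => x.
  rewrite /Q /=; apply/forallP/eqP => [/(_ i)|-> j]; first by rewrite eqxx => /eqP.
  by apply/implyP=> /eqP/hI->.
rewrite -[RHS]w1; apply: eq_bigl => x; apply/forallP=> i.
by apply/implyP=> /eqP hij; rewrite -hij codom_f in jh.
Qed.

(** * Injective simplicial maps and flags *)

Section Embedding.
Variables (T U : finType) (f : T -> U).
Hypothesis f_inj : injective f.

Definition simg (s : {set T}) : {set U} := f @: s.

Lemma simg_inj : injective simg.
Proof. exact: imset_inj. Qed.

Lemma simgS s t : (simg s \subset simg t) = (s \subset t).
Proof.
apply/idP/idP => [/subsetP st|]; last exact: imsetS.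
by apply/subsetP=> x /(imset_f f)/st; rewrite mem_imset.
Qed.

Lemma simg0 s : (simg s == set0) = (s == set0).
Proof. by rewrite imset_eq0. Qed.

Lemma card_simg s : #|simg s| = #|s|.
Proof. exact: card_imset. Qed.

Lemma subset_simgP (s : {set T}) (t : {set U}) :
  t \subset simg s -> exists2 r : {set T}, r \subset s & t = simg r.
Proof.
move=> ts; exists (s :&: f @^-1: t); first exact: subsetIl.
apply/setP=> y; apply/idP/imsetP => [yt|[x]].
  by have /imsetP[x xs yE] := subsetP ts y yt; exists x => //; rewrite !inE xs -yE.
by rewrite !inE => /andP[_ xt ->].
Qed.

End Embedding.

Lemma SdP (T : finType) (K : {set {set T}}) (c : {set {set T}}) :
  reflect [/\ c != set0, {subset c <= K} &
           {in c &, forall s t : {set T}, (s \subset t) || (t \subset s)}] (c \in Sd K).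
Proof.
rewrite inE; apply: (iffP and3P) => [[c0 /subsetP cK ch]|[c0 cK ch]]; split=> //.
- by move=> s t sc; have /forall_inP/(_ s sc)/forall_inP := ch; apply.
- exact/subsetP.
- by apply/forall_inP=> s sc; apply/forall_inP=> t; apply: ch.
Qed.

Section Flags.
Variables (T U : finType) (f : T -> U).
Hypothesis f_inj : injective f.
Variables (K : {set {set T}}) (L : {set {set U}}).

Lemma Sd_simg c : {in K, forall s, simg f s \in L} ->
  c \in Sd K -> simg (simg f) c \in Sd L.
Proof.
move=> fKL /SdP[c0 cK ch]; apply/SdP; split; first by rewrite simg0.
  by move=> _ /imsetP[s sc ->]; apply/fKL/cK.
by move=> _ _ /imsetP[s sc ->] /imsetP[t tc ->]; rewrite !simgS // ch.
Qed.

Lemma Sd_preim c : c \in Sd L -> c \subset simg f @: K ->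
  exists2 b, b \in Sd K & c = simg (simg f) b.
Proof.
case/SdP=> c0 _ ch /subset_simgP[b /subsetP bK cE].
exists b => //; apply/SdP; split=> // [|s t sb tb].
  by rewrite -(simg0 (simg f)) -cE.
by rewrite -!(simgS f_inj) ch // cE imset_f.
Qed.

End Flags.
(** * Restriction of cochains and of [Veps] *)

Section Pullback.
Variables (T U : finType) (f : T -> U) (K : {set {set T}}) (L : {set {set U}}).
Hypotheses (f_inj : injective f) (fKL : {in K, forall s, simg f s \in L}).

Fact face_map_subproof m (s : face K m) :
  (simg f (val s) \in L) && (#|simg f (val s)| == m).
Proof. by case: s => s /= /andP[sK sm]; rewrite fKL //= card_simg. Qed.

Definition face_map m (s : face K m) : face L m :=
  Sub (simg f (val s)) (face_map_subproof s).

Lemma face_map_inj m : injective (@face_map m).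
Proof. by move=> s t /(congr1 val)/(simg_inj f_inj)/val_inj. Qed.

Definition pull m (e : chain L m) : chain K m := [ffun s => e (face_map s)].

Fact pull_is_linear m : linear (@pull m).
Proof. by move=> a u v; apply/ffunP=> s; rewrite !ffunE. Qed.

HB.instance Definition _ m :=
  GRing.isLinear.Build 'F_2 (chain L m) (chain K m) _ (@pull m)
    (@pull_is_linear m).

(** The faces of [simg f s] are the images of the faces of [s]. *)
Lemma pull_cobd m (e : chain L m) :
  is_complex K -> is_complex L -> cobd (pull e) = pull (cobd e).
Proof.
move=> [_ KS] [L0 _]; apply/ffunP=> s; rewrite !ffunE.
under eq_bigr do rewrite ffunE.
have inj : {in [pred t : face K m | val t \subset val s] &,
  injective (@face_map m)} by move=> t t' _ _; apply: face_map_inj.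
rewrite -(big_imset (fun t => e t) inj) /=; apply: eq_bigl => t.
apply/imsetP/idP => [[t' ts ->]|]; first by rewrite /= simgS.
move=> /subset_simgP[r rs tE].
have /andP[tL tm] := valP t; have /andP[sK _] := valP s.
have rP : (r \in K) && (#|r| == m).
  rewrite -(card_simg f_inj) -tE tm andbT (KS _ _ sK _ rs) //.
  by rewrite -(simg0 f) -tE L0.
by exists (Sub r rP) => //; apply: val_inj.
Qed.

Lemma sum_mu_pull (R : realType) (nu : R) m (F : chain K m -> R) :
  \sum_(e : chain L m) mu nu e * F (pull e) =
  \sum_(e : chain K m) mu nu e * F e.
Proof.
apply: (sum_prod_restrict (w := fun x : 'F_2 => if x == 0 then nu else 1 - nu)).
  exact: face_map_inj.
by rewrite !big_ord_recl big_ord0 /= addr0 addrC subrK.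
Qed.

Lemma Veps_simg k (e : chain L k) x : is_complex K -> is_complex L ->
  x \in Veps (pull e) -> simg (simg f) x \in Veps e.
Proof.
move=> KC LC /bigcupP[s]; rewrite pull_cobd // ffunE => es.
rewrite inE => /andP[xK /exists_inP[c cK /and3P[xc sc /forall_inP smin]]].
apply/bigcupP; exists (face_map s) => //.
rewrite inE (Sd_simg f_inj fKL xK) /=; apply/exists_inP.
exists (simg (simg f) c); first exact: Sd_simg cK.
rewrite simgS; last exact: simg_inj.
rewrite xc imset_f //=.
by apply/forall_inP=> _ /imsetP[t tc ->]; rewrite simgS // smin.
Qed.

(** [y] is a face of a flag [c] that starts at a simplex where [cobd e] does not
    vanish.  Locating [c] in the copy also locates that simplex there, so the
    hypothesis concerns all the flags containing [y]. *)
Lemma Veps_preim k (e : chain L k) y : is_complex K -> is_complex L ->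
  y \in Veps e ->
  {in Sd L, forall c : {set {set U}}, y \subset c -> c \in simg (simg f) @: Sd K} ->
  y \in simg (simg f) @: Veps (pull e).
Proof.
move=> KC LC /bigcupP[s es]; rewrite inE.
case/andP=> yL /exists_inP[c cL /and3P[yc sc /forall_inP smin]] star.
have /imsetP[b bK cE] := star c cL yc.
have [x xb yE] : exists2 x : {set {set T}}, x \subset b & y = simg (simg f) x.
  by apply: subset_simgP; rewrite -cE.
have /imsetP[r rb sE] : val s \in simg (simg f) b by rewrite -cE.
have rK : r \in K by have /SdP[_ ->] := bK.
have rP : (r \in K) && (#|r| == k.+1).
  by rewrite rK -(card_simg f_inj) -sE; have /andP[] := valP s.
apply/imsetP; exists x => //; apply/bigcupP; exists (Sub r rP).
  rewrite pull_cobd // ffunE; suff -> : face_map (Sub r rP) = s by [].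
  exact: val_inj.
have [SdP SdS] := Sd_complex K.
rewrite inE (SdS b) //=; last first.
  by rewrite -(simg0 (simg f)) -yE; move: yL; rewrite inE => /andP[].
apply/exists_inP; exists b => //; rewrite xb rb.
by apply/forall_inP=> t tb; rewrite -(simgS f_inj) -sE smin // cE imset_f.
Qed.

End Pullback.

(** * Betti numbers of an isomorphic copy *)

Section Betti.
Variables (T U : finType) (f : T -> U) (K : {set {set T}}).
Hypothesis f_inj : injective f.
Let L := simg f @: K.

Fact simg_in_image : {in K, forall s, simg f s \in L}.
Proof. exact: imset_f. Qed.

Local Notation fm := (face_map f_inj simg_in_image).
Local Notation pl := (pull f_inj simg_in_image).

Lemma face_map_bij m : bijective (@fm m).
Proof.
apply: inj_card_bij; first exact: face_map_inj.
rewrite -(card_imset _ (@face_map_inj _ _ _ _ _ f_inj simg_in_image m)).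
apply/subset_leq_card/subsetP=> t _; have /andP[/imsetP[r rK tE] tm] := valP t.
have rP : (r \in K) && (#|r| == m) by rewrite rK -(card_simg f_inj) -tE.
by apply/imsetP; exists (Sub r rP) => //; apply: val_inj.
Qed.

Lemma pull_bd m (c : chain L m.+1) : bd (pl c) = pl (bd c).
Proof.
apply/ffunP=> t; rewrite !ffunE [RHS](reindex (@fm m.+1)) /=; last first.
  exact: onW_bij (face_map_bij _).
by apply: eq_big => [s|s _]; rewrite ?simgS // ffunE.
Qed.

Lemma pull_lker0 m : lker (linfun (@pl m)) == 0%VS.
Proof.
have [g gK Kg] := face_map_bij m.
apply/lker0P=> u v; rewrite !lfunE => /ffunP uv.
by apply/ffunP=> t; have := uv (g t); rewrite !ffunE Kg.
Qed.

Lemma pull_limg m : limg (linfun (@pl m)) = fullv.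
Proof.
have [g gK Kg] := face_map_bij m.
apply/eqP; rewrite eqEsubv subvf; apply/subvP=> v _.
apply/memv_imgP; exists [ffun t => v (g t)]; first exact: memvf.
by apply/ffunP=> s; rewrite lfunE !ffunE gK.
Qed.

(** [pull] is an isomorphism that intertwines the boundary operators, so these
    have equal ranks, and a Betti number depends only on two ranks and on a
    number of faces. *)
Lemma betti_simg p : betti L p = betti K p.
Proof.
have dimL m (V : {vspace chain L m}) : \dim (linfun (@pl m) @: V) = \dim V.
  by apply: limg_dim_eq; rewrite (eqP (pull_lker0 m)) capv0.
have rk m : \dim (limg (linfun (@bd _ L m))) = \dim (limg (linfun (@bd _ K m))).
  rewrite -dimL -limg_comp -(pull_limg m.+1) -limg_comp; congr (\dim (_ @: _)).
  by apply/lfunP=> c; rewrite !comp_lfunE !lfunE /= pull_bd.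
have ker M m : \dim (cycles M m) =
    (\dim {:chain M m.+1} - \dim (limg (linfun (@bd _ M m))))%N.
  by rewrite -(limg_ker_dim (linfun (@bd _ M m)) fullv) addnK capfv.
by rewrite /betti /boundaries !ker !rk -(dimL _ fullv) pull_limg.
Qed.

End Betti.
(** * Connected components *)

Section Components.
Variable U : finType.
Implicit Type W : {set {set U}}.

Lemma meets_sym W : connect_sym (meets W).
Proof. by apply: sym_connect_sym => s t; rewrite /meets /= andbCA setIC. Qed.

Lemma componentP W (S : {set {set U}}) x : S \in components W -> x \in S ->
  S = [set y in W | connect (meets W) x y].
Proof.
case/imsetP=> x0 x0W ->; rewrite inE => /andP[xW x0x]; apply/setP=> y.
rewrite !inE; case: (y \in W) => //=.
exact: (same_connect (meets_sym W)).
Qed.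

Lemma component_sub W (S : {set {set U}}) : S \in components W -> S \subset W.
Proof. by case/imsetP=> x0 _ ->; apply/subsetP=> y; rewrite inE => /andP[]. Qed.

Lemma component_neq0 W (S : {set {set U}}) : S \in components W ->
  exists x, x \in S.
Proof. by case/imsetP=> x xW ->; exists x; rewrite inE xW connect0. Qed.

End Components.

(** The hypothesis on [c] says that the copy of [S] cannot be left by a step of
    [meets W]; together with the connectedness of [S] this makes it a whole
    component. *)
Lemma component_simg (T U : finType) (f : T -> U) (V S : {set {set T}})
    (W : {set {set U}}) :
  injective f -> {in V, forall s, simg f s \in W} ->
  S \in components V ->
  {in W, forall c, {in S, forall s, c :&: simg f s != set0 ->
    c \in simg f @: V}} ->
  simg f @: S \in components W.
Proof.
move=> fI fVW SV closed; have [x xS] := component_neq0 SV.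
have SsV := subsetP (component_sub SV); have xV := SsV x xS.
suff -> : simg f @: S = [set y in W | connect (meets W) (simg f x) y].
  by apply/imsetP; exists (simg f x) => //; apply: fVW.
have simgI s t : simg f s :&: simg f t = simg f (s :&: t).
  by rewrite /simg imsetI // => ? ? _ _; apply: fI.
apply/setP=> y; rewrite inE; apply/imsetP/andP => [[s sS ->]|[yW]].
  split; first exact/fVW/SsV.
  move: (sS); rewrite {1}(componentP SV xS) inE => /andP[_ /connectP[l]].
  elim: l x {xS xV} => [|z l IHl] x /= ; first by move=> _ ->.
  case/andP=> /and3P[xV zV xz] lz sE; apply: connect_trans (IHl z lz sE).
  by apply: connect1; rewrite /meets /= !fVW // simgI simg0.
case/connectP=> l; elim: l x xS {xV} => [|z l IHl] x xS /=.
  by move=> _ ->; exists x.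
case/andP=> /and3P[_ zW xz]; rewrite setIC in xz.
have /imsetP[z' z'V zE] := closed z zW x xS xz; rewrite zE; apply: IHl.
rewrite (componentP SV xS) inE z'V connect1 //= /meets /= z'V (SsV x) //=.
by rewrite -(simg0 f) setIC -simgI -zE.
Qed.

Lemma sum_betti_le (U : finType) (W : {set {set U}}) p :
  (\sum_(S in components W) betti S p <= #|W|)%N.
Proof.
rewrite (card_partition (components_partition W)); apply: leq_sum => S _.
apply: leq_trans (leq_subr _ _) _; apply: leq_trans (dimvS (subvf _)) _.
rewrite dimvf /dim /= muln1 card_sig.
by apply/subset_leq_card/subsetP=> s; rewrite inE => /andP[].
Qed.

(** * Propagation through iterated subdivisions *)

Section Iteration.
Variables (T : finType) (K B : {set {set T}}).
Hypothesis K_complex : is_complex K.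

(** A vertex of a subdivision is a simplex of the previous complex, so a vertex
    map at depth [d] induces one at depth [d.+1] by taking images. *)
Fixpoint itermap (f : T -> {set T}) d : iterV T d -> iterV T d.+1 :=
  match d return iterV T d -> iterV T d.+1 with
  | 0 => f
  | d'.+1 => simg (@itermap f d')
  end.
Arguments itermap f d : clear implicits.

(** With [M] the boundary, an interior flag has an interior member: properties
    of interior simplices pass from each depth to the next through it. *)
Lemma notin_Sd (X : finType) (L M : {set {set X}}) c :
  c \in Sd L -> c \notin Sd M -> exists2 s, s \in c & s \notin M.
Proof.
rewrite !inE => /and3P[-> _ ->]; rewrite andbT /= => /subsetPn[s sc sM].
by exists s.
Qed.

Section OneMap.
Variable f : T -> {set T}.
Hypotheses (f_inj : injective f)
           (f_simp : {in K, forall s, simg f s \in Sd K})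
           (f_bd : {in K, forall s, simg f s \in Sd B -> s \in B})
           (f_star : {in K, forall s, s \notin B ->
             {in Sd K, forall c : {set {set T}},
               simg f s \subset c -> c \in simg f @: K}}).

Lemma itermap_inj d : injective (itermap f d).
Proof. by elim: d => // d IHd; apply: simg_inj. Qed.

Lemma itermap_simp d :
  {in iterSd K d, forall s, simg (itermap f d) s \in iterSd K d.+1}.
Proof. by elim: d => // d IHd c; apply: Sd_simg IHd; apply: itermap_inj. Qed.

Lemma itermap_bd d :
  {in iterSd K d, forall s, simg (itermap f d) s \in iterSd B d.+1 ->
    s \in iterSd B d}.
Proof.
elim: d => // d IHd c cK; case/SdP=> _ fcB _.
apply: contraT => /(notin_Sd cK)[s sc /negP[]].
have sK : s \in iterSd K d by have /SdP[_ ->] := cK.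
by apply: IHd => //; apply: fcB; apply: imset_f.
Qed.

(** The member [s] of the flag [b] lies off the boundary, and the members of
    [c] are comparable with [simg f s]: those above it lie in the copy by
    induction, those below it because the copy is closed under faces. *)
Lemma itermap_star d :
  {in iterSd K d, forall s, s \notin iterSd B d ->
    {in iterSd K d.+1, forall c : {set iterV T d.+1},
       simg (itermap f d) s \subset c ->
       c \in simg (itermap f d) @: iterSd K d}}.
Proof.
elim: d => // d IHd b bK bB c cK fbc.
have [s sb sB] := notin_Sd bK bB.
have sK : s \in iterSd K d by have /SdP[_ ->] := bK.
have fsc : simg (itermap f d) s \in c by apply: (subsetP fbc); apply: imset_f.
have [K0 KS] := iterSd_complex d K_complex.
have [K0' _] := iterSd_complex d.+1 K_complex.
have cs : c \subset simg (itermap f d) @: iterSd K d.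
  have /SdP[_ cKd ch] := cK.
  apply/subsetP=> t tc; have /orP[|] := ch _ t fsc tc.
    by apply: IHd => //; apply: cKd.
  case/subset_simgP=> r rs tE; rewrite tE imset_f // (KS _ _ sK _ rs) //.
  by rewrite -(simg0 (itermap f d)) -tE K0' // cKd.
by have [a aK ->] := Sd_preim (@itermap_inj d) cK cs; apply: imset_f.
Qed.

End OneMap.

Lemma itermap_sep (f g : T -> {set T}) :
  (forall s t, s \in K -> s \notin B -> t \in K -> simg f s != simg g t) ->
  forall d s t, s \in iterSd K d -> s \notin iterSd B d -> t \in iterSd K d ->
    simg (itermap f d) s != simg (itermap g d) t.
Proof.
move=> fg; elim=> // d IHd b c bK bB cK.
have [s sb sB] := notin_Sd bK bB.
have sK : s \in iterSd K d by have /SdP[_ ->] := bK.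
apply/eqP=> bc; have : simg (itermap f d) s \in simg (itermap g d.+1) c.
  by rewrite -bc imset_f.
case/imsetP=> t tc; apply/eqP; apply: IHd => //.
by have /SdP[_ ->] := cK.
Qed.

(** The largest member of a flag lies in some copy, and all the others are its
    faces. *)
Lemma itermap_cover (I : finType) (f : I -> T -> {set T}) :
  (forall i, injective (f i)) ->
  {in Sd K, forall c, exists i, c \in simg (f i) @: K} ->
  forall d, {in iterSd K d.+1, forall c,
    exists i, c \in simg (itermap (f i) d) @: iterSd K d}.
Proof.
move=> fI cov; elim=> // d IHd c cK.
have [K0 KS] := iterSd_complex d K_complex.
have [K0' _] := iterSd_complex d.+1 K_complex.
have /SdP[c0 cKd ch] := cK.
have [t0 t0c] := set0Pn _ c0.
case: (arg_maxnP (fun t : {set _} => #|t|) t0c) => t tc tmax.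
have [i /imsetP[s sK tE]] := IHd t (cKd t tc).
suff cs : c \subset simg (itermap (f i) d) @: iterSd K d.
  have [a aK ->] := Sd_preim (itermap_inj (fI i) (d := d)) cK cs.
  by exists i; apply: imset_f.
apply/subsetP=> r rc; have {}rt : r \subset t.
  have /orP[//|tr] := ch r t rc tc.
  have /eqP <- : t == r by rewrite eqEcard tr; apply: tmax.
  exact: subxx.
rewrite tE in rt; have [r' rs rE] := subset_simgP rt.
rewrite rE imset_f // (KS _ _ sK _ rs) //.
by rewrite -(simg0 (itermap (f i) d)) -rE K0' // cKd.
Qed.

End Iteration.
Arguments itermap {T} f d.
(** * The copies of the simplex in its subdivision *)

Section Barycentric.
Variable n : nat.
Implicit Types s t : 'S_n.+1.

Definition initial s (i : 'I_n.+1) : {set 'I_n.+1} :=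
  s @: [set j : 'I_n.+1 | j <= i]%N.

Lemma card_initial s i : #|initial s i| = i.+1.
Proof.
rewrite card_imset; last exact: perm_inj.
by rewrite cardsE -sum1_card (big_ord_narrow (ltn_ord i)) sum1_card card_ord.
Qed.

Lemma mem_initial s i j : (s j \in initial s i) = (j <= i)%N.
Proof. by rewrite mem_imset ?inE //; apply: perm_inj. Qed.

Lemma initial_inj s : injective (initial s).
Proof.
move=> i j /(congr1 (fun A : {set _} => #|A|)).
by rewrite !card_initial => -[/val_inj].
Qed.

Lemma initial_chain s i j :
  (initial s i \subset initial s j) || (initial s j \subset initial s i).
Proof.
have sub (a b : 'I_n.+1) : (a <= b)%N -> initial s a \subset initial s b.
  move=> ab; apply: imsetS; apply/subsetP=> x; rewrite !inE => /leq_trans; exact.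
by case/orP: (leq_total i j) => /sub->; rewrite ?orbT.
Qed.

Lemma initial_determines s t : initial s =1 initial t -> s = t.
Proof.
move=> st; apply/permP=> i; rewrite -[s i](permKV t).
set j := (t^-1)%g (s i); congr (t _).
have ij (k : 'I_n.+1) : (j <= k)%N = (i <= k)%N.
  by rewrite -(mem_initial t) permKV -st mem_initial.
by apply/val_inj/eqP; rewrite eqn_leq ij leqnn -ij leqnn.
Qed.

Lemma initial_simp s : {in Delta n, forall a, simg (initial s) a \in Sd (Delta n)}.
Proof.
move=> a; rewrite inE => a0; apply/SdP; split; first by rewrite simg0.
  by move=> _ /imsetP[i _ ->]; rewrite inE -card_gt0 card_initial.
by move=> _ _ /imsetP[i _ ->] /imsetP[j _ ->]; apply: initial_chain.
Qed.

Lemma notin_bdDelta (a : {set 'I_n.+1}) :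
  a \in Delta n -> a \notin bdDelta n -> a = setT.
Proof. by rewrite !inE => ->; rewrite negbK => /eqP. Qed.

Lemma initial_bd s :
  {in Delta n, forall a, simg (initial s) a \in Sd (bdDelta n) ->
    a \in bdDelta n}.
Proof.
move=> a aD /SdP[_ fa _]; apply: contraT => /(notin_bdDelta aD) aT.
have : initial s ord_max \in bdDelta n by apply/fa/imset_f; rewrite aT.
rewrite inE => /andP[_ /negP[]].
by rewrite eqEcard subsetT cardsT card_ord card_initial leqnn.
Qed.

Lemma initial_star s : {in Delta n, forall a, a \notin bdDelta n ->
  {in Sd (Delta n), forall c : {set {set 'I_n.+1}},
    simg (initial s) a \subset c -> c \in simg (initial s) @: Delta n}}.
Proof.
move=> a aD /(notin_bdDelta aD) aT; rewrite {}aT in aD *.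
move=> c /SdP[c0 cD ch] /subsetP fc.
suff -> : c = simg (initial s) setT by apply: imset_f.
apply/eqP; rewrite eqEsubset andbC; apply/andP; split; first exact/subsetP.
apply/subsetP=> b bc; have b0 := cD b bc; rewrite inE -card_gt0 in b0.
have bn : (#|b|.-1 < n.+1)%N by rewrite prednK // (leq_trans (max_card _)) ?card_ord.
(* [initial s i] is the member of the maximal flag with as many vertices as [b]. *)
pose i : 'I_n.+1 := Ordinal bn.
have ic : initial s i \in c by apply/fc/imset_f.
suff -> : b = initial s i by apply: imset_f.
have bi : #|b| = #|initial s i| by rewrite card_initial /= prednK.
apply/eqP; have /orP[bs|sb] := ch _ _ bc ic; first by rewrite eqEcard bs bi leqnn.
by rewrite eq_sym eqEcard sb bi leqnn.
Qed.

Lemma initial_sep s t : s != t -> forall a b : {set 'I_n.+1},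
  a \in Delta n -> a \notin bdDelta n -> b \in Delta n ->
  simg (initial s) a != simg (initial t) b.
Proof.
move=> st a b aD /(notin_bdDelta aD) -> _; apply: contraNneq st => ab.
apply/eqP/initial_determines=> i.
have /imsetP[j _ ij] : initial s i \in simg (initial t) b by rewrite -ab imset_f.
rewrite ij; congr (initial t _); apply/val_inj.
by move/(congr1 (fun A : {set _} => #|A|)): ij; rewrite !card_initial => -[].
Qed.

(** Extending a flag to a maximal one amounts to ordering the vertices so that
    each member of the flag is an initial segment.  Sorting them by the number
    [r] of members that avoid them does this, as the members are nested. *)
Lemma initial_cover :
  {in Sd (Delta n), forall c, exists s, c \in simg (initial s) @: Delta n}.
Proof.
move=> c /SdP[c0 cD ch].
pose r x := #|[set a in c | x \notin a]|.
have r_lt a x y : a \in c -> x \in a -> y \notin a -> (r x < r y)%N.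
  move=> ac xa ya; apply: proper_card; apply/properP; split.
    apply/subsetP=> b; rewrite !inE => /andP[bc xb]; rewrite bc /=.
    have /orP[ab|/subsetP ba] := ch a b ac bc.
      by rewrite (subsetP ab) in xb.
    by apply: contra ya; apply: ba.
  by exists a; rewrite !inE ?ac ?xa ?ya.
pose le := relpre r leq.
have le_tr : transitive le by move=> x y z; apply: leq_trans.
have le_tot : total le by move=> x y; apply: leq_total.
pose l := sort le (enum 'I_n.+1).
have size_l : size l = n.+1 by rewrite size_sort size_enum_ord.
have sf_inj : injective (fun i : 'I_n.+1 => nth ord0 l i).
  move=> i j /eqP; rewrite nth_uniq ?size_l // ?sort_uniq ?enum_uniq //.
  by move/eqP/val_inj.
pose s : 'S_n.+1 := perm sf_inj; exists s.
have r_mono (i j : 'I_n.+1) : (i <= j)%N -> (r (s i) <= r (s j))%N.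
  rewrite !permE => ij.
  apply: (sorted_leq_nth le_tr _ ord0 (sort_sorted le_tot _)) => //;
    rewrite ?inE ?size_l //.
  by move=> x; apply: leqnn.
suff cs : c \subset simg (initial s) setT.
  have [a _ cE] := subset_simgP cs; rewrite cE; apply: imset_f.
  by rewrite inE -(simg0 (initial s)) -cE.
apply/subsetP=> a ac; have := cD a ac; rewrite inE => /set0Pn[x xa].
have [i0 i0a] : exists i, s i \in a by exists ((s^-1)%g x); rewrite permKV.
case: (@arg_maxnP _ i0 (fun i => s i \in a) (fun i : 'I_n.+1 => i : nat) i0a)
  => i ia imax.
suff -> : a = initial s i by apply: imset_f.
apply/setP=> y; rewrite -(permKV s y) mem_initial.
apply/idP/idP => [|ji]; first exact: imax.
apply: contraT => ja; have := r_lt _ _ _ ac ia ja.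
by rewrite ltnNge r_mono.
Qed.

Definition bary s d := itermap (initial s) d.
Arguments bary s d : clear implicits.

Lemma bary_inj s d : injective (bary s d).
Proof. exact/itermap_inj/initial_inj. Qed.

Lemma bary_simp s d :
  {in iterSd (Delta n) d, forall a,
    simg (bary s d) a \in iterSd (Delta n) d.+1}.
Proof. exact: itermap_simp (@initial_inj s) (@initial_simp s) d. Qed.

(** The restriction of [e] to the copy [s]. *)
Definition subpull d k (e : chain (iterSd (Delta n) d.+1) k) s :
  chain (iterSd (Delta n) d) k := pull (@bary_inj s d) (@bary_simp s d) e.

Lemma Veps_sub (T : finType) (K : {set {set T}}) k (e : chain K k) :
  Veps e \subset Sd K.
Proof. by apply/bigcupsP=> s _; apply/subsetP=> c; rewrite inE => /andP[]. Qed.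

Local Notation D := (iterSd (Delta n)).
Local Notation bdD := (iterSd (bdDelta n)).

Lemma iterSd_Delta_complex d : is_complex (D d).
Proof. exact/iterSd_complex/Delta_complex. Qed.

(** A simplex of [Veps e] meeting the copy of [S] contains the image of a vertex
    [v] of [S].  As [S] avoids the boundary, [v] is interior, and its image has
    all the simplices around it in the copy. *)
Lemma interior_component d k (e : chain (D d.+1) k) s S :
  S \in components (Veps (subpull e s)) -> [disjoint S & bdD d.+1] ->
  simg (bary s d.+1) @: S \in components (Veps e) /\
  [disjoint simg (bary s d.+1) @: S & bdD d.+2].
Proof.
move=> SV Sbd; have SsV := subsetP (component_sub SV).
have VD := subsetP (Veps_sub (subpull e s)).
split.
  apply: (component_simg _ _ SV); first exact: bary_inj.
    by move=> c;
      apply: (Veps_simg (iterSd_Delta_complex d) (iterSd_Delta_complex d.+1)).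
  move=> c cV a aS /set0Pn[y]; rewrite in_setI => /andP[yc /imsetP[v va yE]].
  have := Veps_preim (@bary_inj s d) (@bary_simp s d)
    (iterSd_Delta_complex d) (iterSd_Delta_complex d.+1) cV.
  apply; move=> b bD cb.
  have vS : [set v] \in S.
    have [_ KS] := component_complex (Veps_complex (subpull e s)) SV.
    by apply: KS aS _ _; rewrite ?sub1set // -card_gt0 cards1.
  have vK : [set v] \in D d.+1 by exact/VD/SsV.
  have vB : [set v] \notin bdD d.+1 by rewrite (disjointFr Sbd vS).
  have star := itermap_star (Delta_complex n) (@initial_inj s) (@initial_star s).
  apply: (star d.+1 _ vK vB _ bD).
  by rewrite /simg imset_set1 sub1set (subsetP cb) // -[itermap _ _ _]yE.
rewrite disjoint_subset; apply/subsetP=> _ /imsetP[a aS ->]; rewrite inE.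
apply: contraL aS => abd; apply: contraT; rewrite negbK => aS.
rewrite -(disjointFr Sbd aS); apply: (itermap_bd (@initial_bd s) (d := d.+1)) abd.
exact/VD/SsV.
Qed.

(** The interior components of the restrictions inject into those of
    [Veps e], with equal Betti numbers. *)
Lemma sum_btilde_subpull d k p (e : chain (D d.+1) k) :
  (\sum_s btilde p (subpull e s) <= btilde p e)%N.
Proof.
pose A := [set q : 'S_n.+1 * {set {set iterV 'I_n.+1 d.+1}} |
  (q.2 \in components (Veps (subpull e q.1))) && [disjoint q.2 & bdD d.+1]].
pose h (q : 'S_n.+1 * {set {set iterV 'I_n.+1 d.+1}}) :=
  simg (bary q.1 d.+1) @: q.2.
have h_inj : {in A &, injective h}.
  move=> [s S] [t S']; rewrite !inE /= => /andP[SV Sbd] /andP[SV' _].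
  rewrite /h /= => hE.
  have [x xS] := component_neq0 SV.
  have /imsetP[y yS xyE] : simg (bary s d.+1) x \in simg (bary t d.+1) @: S'.
    by rewrite -hE imset_f.
  have inD s' S1 z : S1 \in components (Veps (subpull e s')) -> z \in S1 ->
      z \in D d.+1.
    move=> S1V zS1; apply: (subsetP (Veps_sub (subpull e s'))).
    exact: (subsetP (component_sub S1V)).
  have st : s = t.
    apply: contraTeq isT => st.
    have := itermap_sep (initial_sep st) (inD _ _ _ SV xS) _ (inD _ _ _ SV' yS).
    by rewrite (disjointFr Sbd xS) => /(_ isT); rewrite xyE eqxx.
  rewrite -st in hE *; congr (_, _); apply: imset_inj hE.
  exact: (simg_inj (@bary_inj s d.+1)).
rewrite /btilde (pair_big_dep xpredT) /=.
rewrite (eq_bigl [in A]) => [|q]; last by rewrite inE.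
rewrite (eq_bigr (fun q => betti (h q) p)) => [|q _]; last first.
  by rewrite /h betti_simg //; apply: bary_inj.
rewrite -(big_imset (fun S => betti S p) h_inj) /=.
rewrite [X in (_ <= X)%N](bigID [in h @: A]) /=.
apply: leq_trans (leq_addr _ _); apply: eq_leq; apply: eq_bigl => S.
case: imsetP => [[q qA ->]|]; last by rewrite andbF.
rewrite andbT; apply/esym/andP; move: qA; rewrite inE => /andP[].
exact: interior_component.
Qed.

Lemma card_iterSd d : (#|D d.+1| <= (n.+1)`! * #|D d|)%N.
Proof.
pose h (q : 'S_n.+1 * {set iterV 'I_n.+1 d}) := simg (bary q.1 d) q.2.
rewrite -card_Sn -cardsT -cardsX.
apply: leq_trans (leq_imset_card h _); apply/subset_leq_card/subsetP=> c cD.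
have [s /imsetP[b bD cE]] :=
  itermap_cover (Delta_complex n) initial_inj initial_cover cD.
by apply/imsetP; exists (s, b); rewrite // inE in_setT.
Qed.

Lemma btilde_le d k p (e : chain (D d) k) :
  (btilde p e <= (n.+1)`! ^ d.+1 * #|Delta n|)%N.
Proof.
have cardD m : (#|D m| <= (n.+1)`! ^ m * #|Delta n|)%N.
  elim: m => [|m IHm]; first by rewrite mul1n.
  apply: leq_trans (card_iterSd m) _.
  by rewrite expnS -mulnA leq_mul2l IHm orbT.
apply: leq_trans (cardD d.+1).
apply: leq_trans (subset_leq_card (Veps_sub e)).
apply: leq_trans (sum_betti_le (Veps e) p).
rewrite [X in (_ <= X)%N](bigID (fun S : {set {set iterV 'I_n.+1 d.+1}} =>
  [disjoint S & bdD d.+1])) /=.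
exact: leq_addr.
Qed.

End Barycentric.

(** * Expectations *)

Section Expectation.
Variables (R : realType) (n k p : nat) (nu : R).
Hypotheses (nu_ge0 : 0 <= nu) (nu_le1 : nu <= 1).

Lemma mu_ge0 (T : finType) (K : {set {set T}}) m (e : chain K m) :
  0 <= mu nu e.
Proof. by apply: prodr_ge0 => t _; case: ifP; rewrite ?subr_ge0. Qed.

Lemma Ebtilde_step d :
  (n.+1)`!%:R * Ebtilde n k p nu d <= Ebtilde n k p nu d.+1.
Proof.
have -> : (n.+1)`!%:R * Ebtilde n k p nu d =
    \sum_(e : chain (iterSd (Delta n) d.+1) k)
      mu nu e * (\sum_s btilde p (subpull e s))%N%:R.
  under [RHS]eq_bigr do rewrite natr_sum mulr_sumr.
  rewrite exchange_big /= -card_Sn mulr_natl -sumr_const; apply: eq_big => // s _.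
  by rewrite (sum_mu_pull _ _ _ (fun e => (btilde p e)%:R)).
apply: ler_sum => e _; apply: ler_wpM2l; first exact: mu_ge0.
by rewrite ler_nat sum_btilde_subpull.
Qed.

Lemma Ebtilde_le d :
  Ebtilde n k p nu d <= ((n.+1)`! ^ d.+1 * #|Delta n|)%:R.
Proof.
set M := _%:R; rewrite -[M]mul1r -(mu_total (iterSd (Delta n) d) k nu) mulr_suml.
apply: ler_sum => e _; apply: ler_wpM2l; first exact: mu_ge0.
by rewrite ler_nat btilde_le.
Qed.

End Expectation.

Theorem theorem1p2 (R : realType) (n k p : nat)
  (n_gt0 : (0 < n)%N) (k_gt0 : (1 <= k)%N) (k_le_n : (k <= n)%N)
  (p_le : (p <= n - k)%N) (nu : R) (nu_ge0 : 0 <= nu) (nu_le1 : nu <= 1) :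
  let u := fun d : nat => Ebtilde n k p nu d / ((n.+1)`! ^ d)%:R in
  {homo u : c d / (c <= d)%N >-> c <= d} /\
  (exists M : R, forall d : nat, u d <= M).
Proof.
move=> u; have pow_gt0 d : 0 < ((n.+1)`! ^ d)%:R :> R.
  by rewrite ltr0n expn_gt0 fact_gt0.
split.
  apply: homo_leq => [x|y x z|d]; [exact: lexx | exact: le_trans |].
  rewrite /u ler_pdivrMr // mulrAC ler_pdivlMr // expnS natrM mulrA.
  rewrite ler_pM2r // mulrC; exact: Ebtilde_step.
exists ((n.+1)`! * #|Delta n|)%:R => d.
rewrite /u ler_pdivrMr // -natrM mulnAC -expnS; exact: Ebtilde_le.
Qed.
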